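(* Let $A\in\mathbb{R}^{m\times n}$ be semimonotone ($A^{\dagger}\geq 0$) and let $(U_k,V_k,E_k)_{k=1}^{p}$ be a proper weak regular multisplitting of $A$ with $R(E_k)\subseteq R(A^{T})$ for each $k=1,\ldots,p$. Let $H=\sum_{k=1}^{p}E_kU_k^{\dagger}V_k$. Let $\underline{U},\overline{U}\in\mathbb{R}^{m\times n}$ be such that $\overline{U}^{\dagger}\leq U_k^{\dagger}\leq\underline{U}^{\dagger}$ for each $k=1,\ldots,p$. (i) If $A=\overline{U}-\overline{V}$ is a proper regular splitting and the row sums of $\overline{U}^{\dagger}$ are positive, then $\rho(H)\leq\rho(\overline{U}^{\dagger}\overline{V})$. (ii) If $A=\underline{U}-\underline{V}$ is a proper regular splitting, then $\rho(\underline{U}^{\dagger}\underline{V})\leq\rho(H)$.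
   Context: $A^{\dagger}$ denotes the Moore–Penrose inverse, $\rho(\cdot)$ the spectral radius, $R(\cdot)$, $N(\cdot)$ range and null space; inequalities are entrywise. A splitting $A=U-V$ is proper if $R(U)=R(A)$ and $N(U)=N(A)$; a proper splitting is proper weak regular if $U^{\dagger}\geq 0$ and $U^{\dagger}V\geq 0$, and proper regular if $U^{\dagger}\geq 0$ and $V\geq 0$. A proper weak regular multisplitting of $A$ is a triplet $(U_k,V_k,E_k)_{k=1}^{p}$ where each $A=U_k-V_k$ is a proper weak regular splitting and each $E_k\geq 0$ is an $n\times n$ diagonal matrix with $\sum_{k=1}^{p}E_k=I_n$. *)

(* Defs.v *)
From HB Require Import structures.
From mathcomp Require Import all_boot all_order all_algebra.
From mathcomp Require Import reals.
From mathcomp.real_closed Require Import complex.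
Set Implicit Arguments. Unset Strict Implicit. Unset Printing Implicit Defensive.
Import Order.TTheory GRing.Theory Num.Theory.
Local Open Scope ring_scope.

Definition mx_nonneg (R : realType) m n (M : 'M[R]_(m, n)) : Prop :=
  forall i j, 0 <= M i j.
Definition mx_le (R : realType) m n (M N : 'M[R]_(m, n)) : Prop :=
  forall i j, M i j <= N i j.

(** Moore-Penrose inverse: X is the Moore-Penrose inverse of A
    (the four Penrose equations; over the reals the adjoint is the transpose).
    It exists and is unique for every real matrix. *)
Definition is_mpinv (R : realType) m n (A : 'M[R]_(m, n)) (X : 'M[R]_(n, m)) : Prop :=
  [/\ A *m X *m A = A, X *m A *m X = X,
      (A *m X)^T = A *m X & (X *m A)^T = X *m A].

Definition in_range (R : realType) m n (A : 'M[R]_(m, n)) (y : 'cV[R]_m) : Prop :=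
  exists x : 'cV[R]_n, y = A *m x.
Definition in_null (R : realType) m n (A : 'M[R]_(m, n)) (x : 'cV[R]_n) : Prop :=
  A *m x = 0.

Definition proper_splitting (R : realType) m n (A U V : 'M[R]_(m, n)) : Prop :=
  [/\ A = U - V,
      (forall y, in_range U y <-> in_range A y) &
      (forall x, in_null U x <-> in_null A x)].

Definition proper_weak_regular (R : realType) m n (A U V : 'M[R]_(m, n))
    (Ud : 'M[R]_(n, m)) : Prop :=
  [/\ proper_splitting A U V, is_mpinv U Ud, mx_nonneg Ud & mx_nonneg (Ud *m V)].

Definition proper_regular (R : realType) m n (A U V : 'M[R]_(m, n))
    (Ud : 'M[R]_(n, m)) : Prop :=
  [/\ proper_splitting A U V, is_mpinv U Ud, mx_nonneg Ud & mx_nonneg V].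

Definition proper_weak_regular_multisplitting (R : realType) m n p
    (A : 'M[R]_(m, n)) (U V : 'I_p -> 'M[R]_(m, n)) (Ud : 'I_p -> 'M[R]_(n, m))
    (E : 'I_p -> 'M[R]_n) : Prop :=
  [/\ forall k, proper_weak_regular A (U k) (V k) (Ud k),
      forall k, mx_nonneg (E k) /\ is_diag_mx (E k) &
      \sum_(k < p) E k = 1%:M].

Lemma char_poly_splits (R : realType) n (A : 'M[R[i]]_n) :
  exists s : seq R[i], char_poly A == \prod_(z <- s) ('X - z%:P).
Proof.
have [s Hs] := closed_field_poly_normal (char_poly A).
by exists s; apply/eqP; rewrite Hs (monicP (char_poly_monic A)) scale1r.
Qed.

Definition cspectrum (R : realType) n (A : 'M[R[i]]_n) : seq R[i] :=
  xchoose (char_poly_splits A).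

Definition spectral_radius (R : realType) n (A : 'M[R]_n) : R :=
  \big[Num.max/0]_(z <- cspectrum (map_mx (real_complex R) A)) ComplexField.Normc.normc z.

(* Main.v *)
(** The hypothesis R(E_k) <= R(A^T) together with sum_k E_k = I forces A to have full
    column rank, so Ad A = I, and every splitting A = U - V at hand satisfies
    Ud V Ad = Ad - Ud.  Hence H Ad = Ad - sum_k E_k Ud_k lies entrywise between
    Ad - Ulowd and Ad - Ubard.  Perron vectors are avoided: for t above the spectral
    radius of a nonnegative matrix M the resolvent (t - M)^-1 is nonnegative, and it
    produces a positive (left or right) supersolution M' x <= t x for the matrix M' to
    be bounded, whence rho(M') <= t. *)
Require Import Defs.
From HB Require Import structures.
From mathcomp Require Import all_boot all_order all_algebra.
From mathcomp Require Import reals.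
From mathcomp.real_closed Require Import complex.
From mathcomp Require Import classical_sets.
From mathcomp.real_closed Require Import polyrcf.
From mathcomp Require Import lra.
Set Implicit Arguments. Unset Strict Implicit. Unset Printing Implicit Defensive.
Import Order.TTheory GRing.Theory Num.Theory.
Local Open Scope ring_scope.

(** * Entrywise nonnegative matrices *)

Lemma mulmx_nonneg (R : realType) m n p (M : 'M[R]_(m, n)) (N : 'M[R]_(n, p)) :
  mx_nonneg M -> mx_nonneg N -> mx_nonneg (M *m N).
Proof. by move=> hM hN i j; rewrite mxE sumr_ge0 // => k _; rewrite mulr_ge0. Qed.

Lemma addmx_nonneg (R : realType) m n (M N : 'M[R]_(m, n)) :
  mx_nonneg M -> mx_nonneg N -> mx_nonneg (M + N).
Proof. by move=> hM hN i j; rewrite mxE addr_ge0. Qed.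

Lemma scalemx_nonneg (R : realType) m n (a : R) (M : 'M[R]_(m, n)) :
  0 <= a -> mx_nonneg M -> mx_nonneg (a *: M).
Proof. by move=> ha hM i j; rewrite mxE mulr_ge0. Qed.

Lemma const_mx1_nonneg (R : realType) m n :
  mx_nonneg (const_mx 1 : 'M[R]_(m, n)).
Proof. by move=> i j; rewrite mxE ler01. Qed.

Lemma mx_le_sub (R : realType) m n (M N : 'M[R]_(m, n)) :
  mx_le M N <-> mx_nonneg (N - M).
Proof.
by split=> h i j; have := h i j; rewrite !mxE subr_ge0.
Qed.

Lemma mulmx_const1E (R : realType) m n (M : 'M[R]_(m, n)) i :
  (M *m (const_mx 1 : 'cV_n)) i 0 = \sum_j M i j.
Proof. by rewrite mxE; apply: eq_bigr => j _; rewrite mxE mulr1. Qed.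

(** * Spectral radius: eigenvalue bounds and positive supersolutions *)

Lemma mem_cspectrum (R : realType) n (M : 'M[R[i]]_n) z :
  (z \in cspectrum M) = root (char_poly M) z.
Proof.
rewrite -(root_prod_XsubC (cspectrum M)); congr root.
exact/esym/eqP/(xchooseP (char_poly_splits M)).
Qed.

Lemma spectral_radius_ge0 (R : realType) n (M : 'M[R]_n) : 0 <= spectral_radius M.
Proof. exact: bigmax_ge_id. Qed.

Lemma spectral_radius_leP (R : realType) n (M : 'M[R]_n) (t : R) : 0 <= t ->
  (forall z, root (char_poly (map_mx (real_complex R) M)) z ->
     ComplexField.Normc.normc z <= t) ->
  spectral_radius M <= t.
Proof.
move=> t0 h; rewrite /spectral_radius big_seq bigmax_le // => z.
by rewrite mem_cspectrum => /h.
Qed.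

Lemma root_spectral_radius (R : realType) n (M : 'M[R]_n) (t : R) :
  root (char_poly M) t -> t <= spectral_radius M.
Proof.
move=> rt; apply: (@le_trans _ _ (ComplexField.Normc.normc (real_complex R t))).
  by rewrite /= expr0n addr0 sqrtr_sqr ler_norm.
rewrite /spectral_radius le_bigmax_seq // mem_cspectrum.
by rewrite -map_char_poly fmorph_root.
Qed.

Lemma char_poly_tr (R : comNzRingType) n (M : 'M[R]_n) :
  char_poly M^T = char_poly M.
Proof.
rewrite /char_poly -[in RHS]det_tr; congr (\det _).
by rewrite /char_poly_mx [in RHS]linearB /= tr_scalar_mx map_trmx.
Qed.

Lemma spectral_radius_tr (R : realType) n (M : 'M[R]_n) :
  spectral_radius M^T = spectral_radius M.
Proof.
apply/eqP; rewrite eq_le; apply/andP; split;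
  apply: spectral_radius_leP; rewrite ?spectral_radius_ge0 // => z.
  rewrite -map_trmx char_poly_tr -mem_cspectrum => hz.
  by apply: le_bigmax_seq.
rewrite -char_poly_tr map_trmx -mem_cspectrum => hz.
by apply: le_bigmax_seq.
Qed.

Lemma normc_sum (R : rcfType) (I : Type) (r : seq I) (F : I -> R[i]) :
  ComplexField.Normc.normc (\sum_(k <- r) F k) <=
  \sum_(k <- r) ComplexField.Normc.normc (F k).
Proof.
elim/big_ind2: _ => [|a b c d hab hcd|//]; first by rewrite ComplexField.Normc.normc0.
by apply: le_trans (le_normcD _ _) _; rewrite lerD.
Qed.

(* A left eigenvector v for z satisfies |z| |v| x <= |v| M x <= t |v| x. *)
Lemma spectral_radius_le (R : realType) n (M : 'M[R]_n) (x : 'cV[R]_n) (t : R) :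
  0 <= t -> mx_nonneg M -> (forall i, 0 < x i 0) ->
  (forall i, (M *m x) i 0 <= t * x i 0) -> spectral_radius M <= t.
Proof.
move=> t0 M0 x0 hx; apply: spectral_radius_leP => // z.
rewrite -eigenvalue_root_char => /eigenvalueP[v hv vN0].
pose w j := ComplexField.Normc.normc (v 0 j).
have w0 j : 0 <= w j by rewrite /w; case: (v 0 j) => a b; exact: sqrtr_ge0.
have hz j : ComplexField.Normc.normc z * w j <= \sum_i w i * M i j.
  have := congr1 (fun u : 'rV_n => u 0 j) hv; rewrite !mxE => e.
  rewrite -ComplexField.Normc.normcM -e; apply: le_trans (normc_sum _ _) _.
  apply: ler_sum => i _; rewrite ComplexField.Normc.normcM mxE /= expr0n addr0.
  by rewrite sqrtr_sqr ger0_norm.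
have [k vk] : exists k, v 0 k != 0.
  apply/existsP; apply: contraNT vN0; rewrite negb_exists => /forallP h.
  by apply/eqP/rowP => j; rewrite mxE; apply/eqP; rewrite -[_ == _]negbK h.
(* This is |v| x, by which the inequality is divided at the end; it is positive because x > 0 and v
   has a nonzero entry at k. *)
have s0 : 0 < \sum_j w j * x j 0.
  rewrite (bigD1 k) //= ltr_pwDl ?sumr_ge0 // => [|j _].
    rewrite mulr_gt0 // lt_neqAle w0 andbT eq_sym.
    by apply: contra vk => /eqP/ComplexField.Normc.eq0_normc ->.
  by rewrite mulr_ge0 // ltW.
rewrite -(ler_pM2r s0) mulr_sumr.
apply: (@le_trans _ _ (\sum_j (\sum_i w i * M i j) * x j 0)).
  by apply: ler_sum => j _; rewrite mulrA ler_wpM2r // ltW.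
under eq_bigr do rewrite mulr_suml; rewrite exchange_big mulr_sumr /=.
apply: ler_sum => i _; rewrite mulrCA; under eq_bigr do rewrite -mulrA.
by rewrite -mulr_sumr ler_wpM2l //; have := hx i; rewrite mxE.
Qed.

Lemma spectral_radius_le_row (R : realType) n (M : 'M[R]_n) (x : 'rV[R]_n) (t : R) :
  0 <= t -> mx_nonneg M -> (forall i, 0 < x 0 i) ->
  (forall i, (x *m M) 0 i <= t * x 0 i) -> spectral_radius M <= t.
Proof.
move=> t0 M0 x0 hx; rewrite -spectral_radius_tr.
apply: (@spectral_radius_le _ _ _ x^T) => // [i j|i|i]; try by rewrite mxE.
by have := hx i; rewrite -trmx_mul !mxE.
Qed.

(** * Nonnegative resolvents *)

(** For nonnegative [M] of positive size this says that [t - M] is a nonsingular M-matrix, which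
    amounts to rho(M) < t. *)
Definition nonneg_resolvent (R : realType) n (M : 'M[R]_n) (t : R) :=
  t%:M - M \in unitmx /\ mx_nonneg (invmx (t%:M - M)).

Lemma resolventE (R : realType) n (M : 'M[R]_n) (t : R) m (y : 'M_(n, m)) i j :
  ((t%:M - M) *m y) i j = t * y i j - (M *m y) i j.
Proof. by rewrite mulmxBl mul_scalar_mx !mxE. Qed.

(** A minimum principle. If y has a negative entry, let i minimise y_i / x_i, with minimum c < 0.
    Then y >= c x with equality at i, so (M y)_i >= c (M x)_i > t y_i, a contradiction. *)
Lemma supersolution_nonneg (R : realType) n (M : 'M[R]_n) (x y : 'cV[R]_n) (t : R) :
  mx_nonneg M -> (forall i, 0 < x i 0) -> (forall i, (M *m x) i 0 < t * x i 0) ->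
  (forall i, 0 <= ((t%:M - M) *m y) i 0) -> forall i, 0 <= y i 0.
Proof.
move=> M0 x0 hx hy k; rewrite leNgt; apply/negP => yk.
case: (arg_minP (fun i => y i 0 / x i 0) (erefl true : xpredT k)).
move=> i _ hi; set c := _ / _ in hi.
have c0 : c < 0 by apply: le_lt_trans (hi k isT) _; rewrite pmulr_llt0 // invr_gt0.
have hc j : c * x j 0 <= y j 0 by rewrite -ler_pdivlMr // hi.
have h1 : c * (M *m x) i 0 <= (M *m y) i 0.
  rewrite !mxE mulr_sumr ler_sum // => j _.
  by rewrite mulrCA ler_wpM2l.
have := hy i; rewrite resolventE => h2.
have h3 : c * (t * x i 0) < c * (M *m x) i 0 by rewrite ltr_nM2l.
have h4 : c * x i 0 = y i 0 by rewrite mulfVK // gt_eqF.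
rewrite mulrCA h4 in h3; lra.
Qed.

(** The minimum principle applied to v and -v kills every kernel vector v of [t - M]. The columns of
    the inverse are sent to unit vectors by [t - M], so it applies to them too. *)
Lemma nonneg_resolvent_supersolution (R : realType) n (M : 'M[R]_n) (x : 'cV[R]_n) (t : R) :
  mx_nonneg M -> (forall i, 0 < x i 0) -> (forall i, (M *m x) i 0 < t * x i 0) ->
  nonneg_resolvent M t.
Proof.
move=> M0 x0 hx; have pos := @supersolution_nonneg _ _ M x _ t M0 x0 hx.
have u : t%:M - M \in unitmx.
  rewrite unitmxE unitfE -det_tr; apply/det0P => -[v vN0 hv].
  have hT : (t%:M - M) *m v^T = 0 by apply: trmx_inj; rewrite trmx_mul trmxK hv trmx0.
  case/eqP: vN0; apply/rowP => j; rewrite mxE; apply/eqP; rewrite eq_le.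
  have := pos (v^T) _ j; rewrite hT mxE => -> //; last by move=> i; rewrite mxE.
  have := pos (- v^T) _ j; rewrite mulmxN hT !mxE oppr_ge0 => -> // i.
  by rewrite !mxE oppr0.
split=> // i j; have := pos (col j (invmx (t%:M - M))) _ i; rewrite mxE; apply.
by move=> k; rewrite colE mulKVmx // mxE ler0n.
Qed.

(** Since t x - M x = e, an entry x_i = 0 would force (M x)_i = -1. Thus x is a strict positive
    supersolution, a converse to the previous lemma. *)
Lemma nonneg_resolvent_row_gt0 (R : realType) n (M : 'M[R]_n) (t : R) :
  mx_nonneg M -> nonneg_resolvent M t ->
  forall i, 0 < (invmx (t%:M - M) *m (const_mx 1 : 'cV_n)) i 0.
Proof.
move=> M0 [u B0] i; set x := _ *m _.
have x0 : mx_nonneg x by apply: mulmx_nonneg => //; exact: const_mx1_nonneg.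
rewrite lt_neqAle x0 andbT eq_sym; apply/eqP => xi.
have : ((t%:M - M) *m x) i 0 = 1 by rewrite /x mulKVmx // mxE.
rewrite resolventE xi mulr0 sub0r => h.
have := mulmx_nonneg M0 x0 i 0; lra.
Qed.

Lemma nonneg_resolvent_open (R : realType) n (M : 'M[R]_n) (t : R) :
  mx_nonneg M -> nonneg_resolvent M t ->
  exists2 d, 0 < d & forall s, t - d < s -> nonneg_resolvent M s.
Proof.
move=> M0 gt; have x0 := nonneg_resolvent_row_gt0 M0 gt.
have [u B0] := gt; set x := _ *m _ in x0.
have S0 : 0 <= \sum_i x i 0 by rewrite sumr_ge0 // => i _; exact: ltW.
(* The vector x remains a strict supersolution at s while (t - s) x_i < 1; the added 1 makes the
   denominator positive and larger than every x_i. *)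
exists (1 + \sum_i x i 0)^-1; first by rewrite invr_gt0; lra.
move=> s hs; apply: (@nonneg_resolvent_supersolution _ _ _ x) => // i.
have : ((t%:M - M) *m x) i 0 = 1 by rewrite /x mulKVmx // mxE.
rewrite resolventE => h.
have xS : x i 0 < 1 + \sum_i x i 0.
  rewrite (bigD1 i) //=.
  have : 0 <= \sum_(j < n | j != i) x j 0 by rewrite sumr_ge0 // => j _; exact: ltW.
  lra.
suff : (t - s) * x i 0 < 1 by lra.
have [ts|ts] := leP t s.
  have : 0 <= (s - t) * x i 0 by rewrite mulr_ge0 ?subr_ge0 // ltW.
  lra.
apply: (@lt_trans _ _ ((t - s) * (1 + \sum_i x i 0))).
  by rewrite ltr_pM2l // subr_gt0.
rewrite -ltr_pdivlMr ?mul1r; lra.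
Qed.

Lemma nonneg_resolvent_ex (R : realType) n (M : 'M[R]_n) :
  mx_nonneg M -> exists t, nonneg_resolvent M t.
Proof.
move=> M0; exists (1 + \sum_i \sum_j M i j).
apply: (@nonneg_resolvent_supersolution _ _ _ (const_mx 1)) => // i.
  by rewrite mxE ltr01.
rewrite mulmx_const1E mxE mulr1 [X in _ < 1 + X](bigD1 i) //=.
have : 0 <= \sum_(k < n | k != i) \sum_j M k j.
  by rewrite sumr_ge0 // => k _; rewrite sumr_ge0.
lra.
Qed.

Lemma poly_ge0_right (R : rcfType) (p : {poly R}) (a : R) :
  (forall s, a < s -> 0 <= p.[s]) -> 0 <= p.[a].
Proof.
move=> h; rewrite leNgt; apply/negP => pa.
have e0 : 0 < - p.[a] by rewrite oppr_gt0.
have [d d0 hd] := poly_cont a p e0.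
have h1 : 0 <= p.[a + d / 2] by apply: h; lra.
have : `|p.[a + d / 2] - p.[a]| < - p.[a].
  by apply: hd; rewrite ger0_norm; lra.
rewrite ger0_norm; lra.
Qed.

Lemma horner_char_poly_mx (R : comNzRingType) n (M : 'M[R]_n) (s : R) :
  map_mx (horner_eval s) (char_poly_mx M) = s%:M - M.
Proof.
by apply/matrixP => i j; rewrite !mxE /horner_eval !hornerE hornerMn hornerX.
Qed.

Lemma nonneg_resolvent_closed (R : realType) n (M : 'M[R]_n) (t : R) :
  (forall s, t < s -> nonneg_resolvent M s) -> t%:M - M \in unitmx ->
  nonneg_resolvent M t.
Proof.
move=> h u; split=> // i j.
(* An entry of the inverse is adj / det; multiplied by det^2 it becomes a polynomial in s, so its
   sign passes to the limit s = t. *)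
pose p := \adj (char_poly_mx M) i j * char_poly M.
have pE s : p.[s] = (\adj (s%:M - M)) i j * \det (s%:M - M).
  rewrite /p hornerM -horner_char_poly_mx det_map_mx -map_mx_adj.
  by congr (_ * _); rewrite [RHS]mxE.
have invE s : s%:M - M \in unitmx ->
    p.[s] = invmx (s%:M - M) i j * (\det (s%:M - M)) ^+ 2.
  move=> us; have -> : invmx (s%:M - M) i j =
      (\det (s%:M - M))^-1 * (\adj (s%:M - M)) i j by rewrite /invmx us [LHS]mxE.
  by rewrite pE expr2 mulrACA mulVf ?mul1r // -unitfE -unitmxE.
have : 0 <= p.[t].
  apply: poly_ge0_right => s /h[us B0].
  by rewrite invE // mulr_ge0 // sqr_ge0.
rewrite invE // pmulr_lge0 // lt_neqAle sqr_ge0 andbT eq_sym expf_neq0 //.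
by rewrite -unitfE -unitmxE.
Qed.

(* The infimum of the t with a nonnegative resolvent is a singular value of
   the pencil t - M, hence an eigenvalue of M, so it cannot exceed rho(M). *)
Lemma nonneg_resolvent_gt_spectral_radius (R : realType) n (M : 'M[R]_n) (t : R) :
  mx_nonneg M -> spectral_radius M < t -> nonneg_resolvent M t.
Proof.
move=> M0 ht; apply: boolp.contrapT => nt.
have up s s' : nonneg_resolvent M s -> s <= s' -> nonneg_resolvent M s'.
  by move=> gs ss'; have [d d0 hd] := nonneg_resolvent_open M0 gs; apply: hd; lra.
pose S : set R := fun s => nonneg_resolvent M s.
have lbt : lbound S t.
  by move=> s gs; rewrite leNgt; apply/negP => /ltW/(up _ _ gs).
have S0 : (S !=set0)%classic by have [s gs] := nonneg_resolvent_ex M0; exists s.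
have infS : has_inf S by split=> //; exists t.
have tinf : t <= inf S by exact: lb_le_inf.
have right s : inf S < s -> nonneg_resolvent M s.
  rewrite -subr_gt0 => /inf_adherent /(_ infS)[r gr hr].
  by apply: (up r) => //; lra.
(* Closedness puts the infimum in [S]; openness then yields a smaller member. *)
have : nonneg_resolvent M (inf S).
  apply: nonneg_resolvent_closed => //; rewrite unitmxE unitfE.
  apply/eqP => d0; have := lt_le_trans ht tinf; apply/negP; rewrite -leNgt.
  apply: root_spectral_radius; rewrite /root -[_.[_]]/(horner_eval _ _) /char_poly.
  by rewrite -det_map_mx horner_char_poly_mx d0.
move=> /(nonneg_resolvent_open M0)[d d0 hd].
have /hd : inf S - d < inf S - d / 2 by lra.
move=> /(@ge_inf _ S _); case: infS => _ lS /(_ lS); lra.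
Qed.

(** * Moore-Penrose inverses and proper splittings *)

Lemma mulmx_range_fix (R : realType) m n p (P : 'M[R]_m) (B : 'M[R]_(m, p))
    (C : 'M[R]_(m, n)) :
  (forall y, in_range B y -> in_range C y) -> P *m C = C -> P *m B = B.
Proof.
move=> BC PC; apply/matrixP => i j.
have [|x Bx] := BC (B *m delta_mx j 0); first by exists (delta_mx j 0).
have : P *m (B *m delta_mx j 0) = B *m delta_mx j (0 : 'I_1).
  by rewrite Bx mulmxA PC.
by rewrite mulmxA -!colE => /colP/(_ i); rewrite !mxE.
Qed.

(** Transposing A Ad A = A shows that the symmetric matrix Ad A fixes A^T, hence every E_k, hence
    their sum I. *)
Lemma mpinv_left_inverse (R : realType) m n p (A : 'M[R]_(m, n)) (Ad : 'M[R]_(n, m))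
    (E : 'I_p -> 'M[R]_n) :
  is_mpinv A Ad -> \sum_(k < p) E k = 1%:M ->
  (forall k (y : 'cV[R]_n), in_range (E k) y -> in_range A^T y) ->
  Ad *m A = 1%:M.
Proof.
move=> [AAdA _ _ sAdA] E1 ran.
rewrite -[LHS]mulmx1 -[X in _ *m X]E1 mulmx_sumr -E1; apply: eq_bigr => k _.
apply: mulmx_range_fix (ran k) _.
by rewrite -sAdA -trmx_mul mulmxA AAdA.
Qed.

(** The columns of I - Ud U lie in N(U) = N(A), which is trivial as Ad A = I. Both U Ud and A Ad are
    the orthogonal projector onto the common range. *)
Lemma proper_splitting_mpinv (R : realType) m n (A U V : 'M[R]_(m, n))
    (Ad Ud : 'M[R]_(n, m)) :
  is_mpinv A Ad -> Ad *m A = 1%:M -> proper_splitting A U V -> is_mpinv U Ud ->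
  Ud *m U = 1%:M /\ U *m Ud = A *m Ad.
Proof.
move=> [AAdA _ sAAd _] AdA [_ ran null] [UUdU _ sUUd _]; split.
  have AU : A *m (1%:M - Ud *m U) = 0.
    apply/matrixP => i j.
    have /null : in_null U ((1%:M - Ud *m U) *m delta_mx j 0).
      by rewrite /in_null mulmxA mulmxBr mulmx1 mulmxA UUdU subrr mul0mx.
    by rewrite /in_null mulmxA -colE => /colP/(_ i); rewrite !mxE.
  apply/eqP; rewrite eq_sym -subr_eq0 -[X in X == _]mul1mx -AdA.
  by rewrite -mulmxA AdA AU mulmx0.
have PU : A *m Ad *m U = U by apply: mulmx_range_fix AAdA => y /ran.
have PA : U *m Ud *m A = A by apply: mulmx_range_fix UUdU => y /ran.
rewrite -[in RHS]PA -[in RHS]mulmxA -[in RHS]sUUd -[in RHS]sAAd -trmx_mul.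
by rewrite mulmxA PU sUUd.
Qed.

(** Put V = U - A and use U Ud = A Ad. With K = Ad V and M = Ud V, the second identity gives K M = K
    - M. *)
Lemma splitting_identities (R : realType) m n (A U V : 'M[R]_(m, n))
    (Ad Ud : 'M[R]_(n, m)) :
  is_mpinv A Ad -> Ad *m A = 1%:M -> proper_splitting A U V -> is_mpinv U Ud ->
  Ud *m V *m Ad = Ad - Ud /\ Ad *m V *m Ud = Ad - Ud.
Proof.
move=> hA AdA hs hU; have [UdU UUd] := proper_splitting_mpinv hA AdA hs hU.
have [_ AdAAd _ _] := hA; have [_ UdUUd _ _] := hU; have [AUV _ _] := hs.
have VE : V = U - A by rewrite AUV opprB addrC subrK.
split; last by rewrite VE mulmxBr AdA mulmxBl mul1mx -mulmxA UUd mulmxA AdAAd.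
by rewrite VE mulmxBr mulmxBl UdU mul1mx -(mulmxA Ud) -UUd mulmxA UdUUd.
Qed.

(** * Comparison with a single proper regular splitting *)

(* For rho(Ud V) < t <= 1 the resolvent provides x > 0 with t x - Ud V x = Ud e;
   it lies in the image under Ad of a nonnegative vector z, on which H Ad z <= Ud V Ad z,
   so x is a positive supersolution for H as well. *)
Lemma spectral_radius_le_splitting (R : realType) m n (A U V : 'M[R]_(m, n))
    (Ad Ud : 'M[R]_(n, m)) (H : 'M[R]_n) :
  is_mpinv A Ad -> mx_nonneg Ad -> Ad *m A = 1%:M ->
  proper_regular A U V Ud -> (forall i, 0 < \sum_j Ud i j) ->
  mx_nonneg H -> mx_le (H *m Ad) (Ad - Ud) ->
  spectral_radius H <= spectral_radius (Ud *m V).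
Proof.
move=> hA Ad0 AdA [hs hU Ud0 V0] row0 H0 HAd.
have [MAd KUd] := splitting_identities hA AdA hs hU.
have M0 : mx_nonneg (Ud *m V) by exact: mulmx_nonneg.
set M := Ud *m V in MAd M0 *; pose e : 'cV[R]_m := const_mx 1.
have e0 : mx_nonneg e by exact: const_mx1_nonneg.
have Ude0 i : 0 < (Ud *m e) i 0 by rewrite mulmx_const1E.
have HMAd (z : 'cV_m) : mx_nonneg z -> mx_le (H *m (Ad *m z)) (M *m (Ad *m z)).
  move=> z0; apply/mx_le_sub; rewrite !mulmxA MAd -mulmxBl.
  by apply: mulmx_nonneg => //; apply/mx_le_sub.
have AdE : Ad *m e = Ud *m e + M *m (Ad *m e).
  by rewrite mulmxA MAd mulmxBl addrC subrK.
have MAde0 i : 0 <= (M *m (Ad *m e)) i 0 by do 2?apply: mulmx_nonneg => //.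
have Ade i : (Ad *m e) i 0 = (Ud *m e) i 0 + (M *m (Ad *m e)) i 0.
  by rewrite {1}AdE mxE.
(* Here Ad e is the supersolution. With this bound only t <= 1 remains to be treated: the midpoint
   of rho(M) < rho(H) is below 1. *)
have H1 : spectral_radius H <= 1.
  apply: (@spectral_radius_le _ _ _ (Ad *m e)) => // i.
    by rewrite Ade ltr_pwDl.
  by rewrite mul1r Ade; apply: le_trans (HMAd e e0 i 0) _; rewrite lerDr ltW.
suff main t : spectral_radius M < t -> t <= 1 -> spectral_radius H <= t.
  rewrite leNgt; apply/negP => MH; have [Mt tH] := midf_lt MH.
  by have := main _ Mt (ltW (lt_le_trans tH H1)); rewrite leNgt tH.
move=> Mt t1; have t0 := le_lt_trans (spectral_radius_ge0 M) Mt.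
have [u B0] := nonneg_resolvent_gt_spectral_radius M0 Mt; clear H1 Mt.
pose x := invmx (t%:M - M) *m (Ud *m e).
have xE : t *: x - M *m x = Ud *m e.
  by rewrite -mul_scalar_mx -mulmxBl /x mulKVmx.
have x0 : mx_nonneg x by do 2?apply: mulmx_nonneg => //.
(* Chosen so that Ad z = t x: with K = Ad V, the relations Ud e = t x - M x and K M = K - M give Ad
   e = t x - (1 - t) K x. Nonnegativity of z uses t <= 1. *)
pose z := (1 - t) *: (V *m x) + e.
have z0 : mx_nonneg z.
  apply: addmx_nonneg => //; apply: scalemx_nonneg; first by rewrite subr_ge0.
  exact: mulmx_nonneg.
have Adz : Ad *m z = t *: x.
  have -> : Ad *m z = (1 - t) *: (Ad *m V *m x) + Ad *m e.
    by rewrite mulmxDr -scalemxAr mulmxA.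
  have -> : Ad *m e = Ud *m e + Ad *m V *m (Ud *m e).
    by rewrite mulmxA KUd -mulmxDl addrC subrK.
  have KM : Ad *m V *m (M *m x) = Ad *m V *m x - M *m x.
    by rewrite mulmxA /M mulmxA KUd !mulmxBl.
  rewrite -xE mulmxBr KM -scalemxAr; apply/matrixP => i j; rewrite !mxE.
  set a := \sum_(_ < _) _; set b := \sum_(_ < _) _; lra.
have Mx i : (M *m x) i 0 = t * x i 0 - (Ud *m e) i 0 by rewrite -xE !mxE; lra.
apply: (@spectral_radius_le _ _ _ x) => // [|i|i]; first exact: ltW.
  have := mulmx_nonneg M0 x0 i 0; rewrite Mx => h.
  by rewrite -(pmulr_rgt0 _ t0); have := Ude0 i; lra.
have := HMAd z z0 i 0; rewrite Adz -!scalemxAr !mxE ler_pM2l // => h.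
by have := Mx i; have := Ude0 i; rewrite !mxE in h *; lra.
Qed.

(* With y = e (t - H)^-1 and K = Ad V, the row y K + e is a positive left supersolution
   for Ud V, because K Ud V = K - Ud V and hence e Ud V <= e K. *)
Lemma splitting_spectral_radius_le (R : realType) m n (A U V : 'M[R]_(m, n))
    (Ad Ud : 'M[R]_(n, m)) (H : 'M[R]_n) :
  is_mpinv A Ad -> mx_nonneg Ad -> Ad *m A = 1%:M ->
  proper_regular A U V Ud ->
  mx_nonneg H -> mx_le (Ad - Ud) (H *m Ad) ->
  spectral_radius (Ud *m V) <= spectral_radius H.
Proof.
move=> hA Ad0 AdA [hs hU Ud0 V0] H0 /mx_le_sub HAd.
have [_ KUd] := splitting_identities hA AdA hs hU.
have M0 : mx_nonneg (Ud *m V) by exact: mulmx_nonneg.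
have K0 : mx_nonneg (Ad *m V) by exact: mulmx_nonneg.
have KM : Ad *m V *m (Ud *m V) = Ad *m V - Ud *m V by rewrite mulmxA KUd mulmxBl.
suff main t : spectral_radius H < t -> spectral_radius (Ud *m V) <= t.
  rewrite leNgt; apply/negP => HM; have [Ht tM] := midf_lt HM.
  by have := main _ Ht; rewrite leNgt tM.
move=> Ht; have t0 := ltW (le_lt_trans (spectral_radius_ge0 H) Ht).
have [u B0] := nonneg_resolvent_gt_spectral_radius H0 Ht; clear Ht.
pose e : 'rV[R]_n := const_mx 1; pose y := e *m invmx (t%:M - H).
have e0 : mx_nonneg e by exact: const_mx1_nonneg.
have y0 : mx_nonneg y by exact: mulmx_nonneg.
have yH : y *m H = t *: y - e.
  rewrite -[X in _ - X](mulmxKV u) -/y mulmxBr mul_mx_scalar.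
  by rewrite opprB addrC subrK.
pose w := y *m (Ad *m V) + e.
apply: (@spectral_radius_le_row _ _ _ w) => // i.
  have : 0 <= (y *m (Ad *m V)) 0 i by exact: mulmx_nonneg.
  by move=> h; rewrite /w mxE ltr_wpDl // mxE ltr01.
have : mx_nonneg (t *: w - w *m (Ud *m V)).
  (* Each summand on the right is nonnegative. The identity comes from y H = t y - e and K M = K -
     M, where K = Ad V and M = Ud V. *)
  have -> : t *: w - w *m (Ud *m V) =
      t *: e + e *m (Ad *m V *m (Ud *m V)) + y *m ((H *m Ad - (Ad - Ud)) *m V).
    have -> : y *m ((H *m Ad - (Ad - Ud)) *m V) =
        t *: (y *m (Ad *m V)) - e *m (Ad *m V) - y *m (Ad *m V) + y *m (Ud *m V).
      have -> : (H *m Ad - (Ad - Ud)) *m V = H *m (Ad *m V) - Ad *m V + Ud *m V.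
        by rewrite !mulmxBl opprB addrA -mulmxA addrAC.
      by rewrite mulmxDr mulmxBr [y *m (H *m _)]mulmxA yH mulmxBl -scalemxAl.
    rewrite /w mulmxDl -[y *m _ *m _]mulmxA KM !mulmxBr scalerDr.
    by apply/matrixP => a b; rewrite !mxE; lra.
  apply: addmx_nonneg; last by do 2?apply: mulmx_nonneg => //.
  apply: addmx_nonneg; first exact: scalemx_nonneg.
  by do 2?apply: mulmx_nonneg => //.
by move/(_ 0 i); rewrite !mxE subr_ge0.
Qed.

Theorem theorem5p9 (R : realType) (m n p : nat)
  (A : 'M[R]_(m, n)) (Ad : 'M[R]_(n, m))
  (U V : 'I_p -> 'M[R]_(m, n)) (Ud : 'I_p -> 'M[R]_(n, m)) (E : 'I_p -> 'M[R]_n)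
  (Ubar Ulow : 'M[R]_(m, n)) (Ubard Ulowd : 'M[R]_(n, m)) :
  is_mpinv A Ad -> mx_nonneg Ad ->
  proper_weak_regular_multisplitting A U V Ud E ->
  (forall k (y : 'cV[R]_n), in_range (E k) y -> in_range A^T y) ->
  is_mpinv Ubar Ubard -> is_mpinv Ulow Ulowd ->
  (forall k, mx_le Ubard (Ud k) /\ mx_le (Ud k) Ulowd) ->
  let H := \sum_(k < p) E k *m (Ud k *m V k) in
  (forall Vbar : 'M[R]_(m, n),
     proper_regular A Ubar Vbar Ubard ->
     (forall i : 'I_n, 0 < \sum_(j < m) Ubard i j) ->
     spectral_radius H <= spectral_radius (Ubard *m Vbar))
  /\
  (forall Vlow : 'M[R]_(m, n),
     proper_regular A Ulow Vlow Ulowd ->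
     spectral_radius (Ulowd *m Vlow) <= spectral_radius H).
Proof.
move=> hA Ad0 [hreg hE E1] ran _ _ hle H.
have AdA := mpinv_left_inverse hA E1 ran.
have E0 k : mx_nonneg (E k) by have [] := hE k.
have H0 : mx_nonneg H.
  move=> i j; rewrite /H summxE sumr_ge0 // => k _.
  by apply: mulmx_nonneg => //; have [] := hreg k.
(* Writing Ad as the sum of the E_k Ad puts both bounds in one formula: X is [Ubard] in (i) and
   [Ulowd] in (ii). *)
have HAd (X : 'M_(n, m)) :
    H *m Ad - (Ad - X) = \sum_(k < p) E k *m (X - Ud k).
  rewrite -[X in _ - X]mul1mx -E1 /H !mulmx_suml -sumrB.
  apply: eq_bigr => k _; have [hs hU _ _] := hreg k.
  have [MAd _] := splitting_identities hA AdA hs hU.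
  by rewrite -mulmxA MAd -mulmxBr opprB addrC addrA subrK.
split=> [Vbar hbar row0|Vlow hlow].
  apply: (spectral_radius_le_splitting hA Ad0 AdA hbar row0 H0); apply/mx_le_sub.
  rewrite -opprB HAd -sumrN => i j; rewrite summxE sumr_ge0 // => k _.
  rewrite -mulmxN opprB; apply: mulmx_nonneg => //; apply/mx_le_sub.
  by have [] := hle k.
apply: (splitting_spectral_radius_le hA Ad0 AdA hlow H0); apply/mx_le_sub.
rewrite HAd => i j; rewrite summxE sumr_ge0 // => k _.
by apply: mulmx_nonneg => //; apply/mx_le_sub; have [] := hle k.
Qed.
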